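(* Algorithm A (described in the context), given the divisor list of $n$, computes $\delta(n)$ in space $O(n)$ and in time $O(n\,\tau^{+}(n))$.
   Context: For a positive integer $n$, let $\delta(n)$ denote the number of elements of $\{mn : 1 \le m \le n\}$ that appear in the $(n-1)\times(n-1)$ multiplication table, i.e. that can be written as $ab$ with $1 \le a,b \le n-1$. Let $\tau(n;y,z)$ be the number of divisors $d$ of $n$ with $y < d \le z$, and let $\tau^{+}(n) = |\{k \in \mathbb{Z} : \tau(n;2^k,2^{k+1}) \ge 1\}|$. Model of computation: a standard random access machine with infinite direct-access memory, addressable at the bit level or at the word level, with word size $\Theta(\log n)$ bits for input $n$. Arithmetic operations, memory accesses and other basic operations take unit time. Space is counted in bits and does not include space used to store the output. Divisor list: let $1 = d_0 < d_1 < \cdots < d_{\ell-1}$ be all divisors of $n$ in $[1,\sqrt n]$. The divisor list of $n$ is $D = [[d_0, n/d_0], \ldots, [d_{\ell-1}, n/d_{\ell-1}]]$, and $D[k][0] = d_k$, $D[k][1] = n/d_k$. Algorithm A. Input: the divisor list $D$ of $n$. Set $k = 0$ and initialize a bit vector $A$ of length $n$ to $0$. For $i = 1, 2, \ldots$ while $i < D[\ell-1][0]$: if $i = D[k][0]$ then increment $k$ by 1; then for every integer $j$ with $i \le j < D[k][1]$ set $A[ij] = 1$. Return the Hamming weight of $A$. *)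

(* Defs.v *)
From mathcomp Require Import all_boot all_order all_algebra finmap.
From mathcomp Require Import boolp classical_sets cardinality.

Set Implicit Arguments.
Unset Strict Implicit.
Unset Printing Implicit Defensive.

(** * Arithmetic functions *)

(* The N x N multiplication table, with repetitions. *)
Definition mult_table (N : nat) : seq nat :=
  [seq a * b | a <- iota 1 N, b <- iota 1 N].

Definition delta (n : nat) : nat :=
  size (undup [seq x <- [seq m * n | m <- iota 1 n] | x \in mult_table n.-1]).

(* Rational endpoints, since [tau_plus] uses [2 ^ k] with [k] negative. *)
Definition tau (n : nat) (y z : rat) : nat :=
  size [seq d <- divisors n | (y < d%:R)%R && (d%:R <= z)%R].

(* [fset_set A] is the finite set of the elements of [A], for [A] finite; here
   [A] is finite for [n > 0], as only -1 <= k < log2 n can contribute. *)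
Definition tau_plus (n : nat) : nat :=
  #|` fset_set [set k : int |
        (1 <= tau n (2%:Q ^ k)%R (2%:Q ^ (k + 1))%R)%N]%classic |%fset.

(* Increasing in the first component, because [divisors n] is sorted. *)
Definition divisor_list (n : nat) : seq (nat * nat) :=
  [seq (d, n %/ d) | d <- divisors n & d ^ 2 <= n].

(** * Random access machine

   The machine has a fixed number of registers and an infinite memory of bits.
   With word size [w], the word of address [a] consists of the bits of
   addresses a * w, ..., a * w + w - 1, least significant bit first.  Word
   arithmetic is modulo 2 ^ w. *)

Definition nreg : nat := 8.
Definition reg : Type := 'I_nreg.

Record state : Type := State { regs : reg -> nat; mem : nat -> bool }.

Definition set_reg (s : state) (r : reg) (v : nat) : state :=
  State (fun r' => if r' == r then v else regs s r') (mem s).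

Definition set_bit (s : state) (p : nat) (b : bool) : state :=
  State (regs s) (fun p' => if p' == p then b else mem s p').

Definition get_word (w : nat) (s : state) (a : nat) : nat :=
  \sum_(i < w) mem s (a * w + i) * 2 ^ i.

Definition set_word (w : nat) (s : state) (a v : nat) : state :=
  State (regs s) (fun p => if a * w <= p < a * w + w
                           then odd (v %/ 2 ^ (p - a * w)) else mem s p).

Inductive op : Type := Add | Sub | Mul | Div | Mod | Eq | Lt.

Definition eval_op (w : nat) (o : op) (a b : nat) : nat :=
  match o with
  | Add => (a + b) %% 2 ^ w
  | Sub => (a + 2 ^ w - b) %% 2 ^ w
  | Mul => (a * b) %% 2 ^ w
  | Div => a %/ b
  | Mod => a %% b
  | Eq => a == b
  | Lt => a < b
  end.

(* [EBit e1 e2] reads the bit at offset [e2] from the start of the word of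
   address [e1], i.e. the bit of address e1 * w + e2; the offset may exceed w.
   The same addressing mode is used by [CBit] below. *)
Inductive expr : Type :=
| EConst of nat
| EReg of reg
| EOp of op & expr & expr
| EWord of expr
| EBit of expr & expr.

Fixpoint eval (w : nat) (s : state) (e : expr) : nat :=
  match e with
  | EConst c => c %% 2 ^ w
  | EReg r => regs s r
  | EOp o e1 e2 => eval_op w o (eval w s e1) (eval w s e2)
  | EWord e1 => get_word w s (eval w s e1)
  | EBit e1 e2 => mem s (eval w s e1 * w + eval w s e2)
  end.

(* Unit cost for each constant, register access, operation and memory read. *)
Fixpoint cost (e : expr) : nat :=
  match e with
  | EConst _ | EReg _ => 1
  | EOp _ e1 e2 => (cost e1 + cost e2).+1
  | EWord e1 => (cost e1).+1
  | EBit e1 e2 => (cost e1 + cost e2).+1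
  end.

(* One more than the largest bit address read (0 if memory is not read). *)
Fixpoint reach (w : nat) (s : state) (e : expr) : nat :=
  match e with
  | EConst _ | EReg _ => 0
  | EOp _ e1 e2 => maxn (reach w s e1) (reach w s e2)
  | EWord e1 => maxn (reach w s e1) ((eval w s e1).+1 * w)
  | EBit e1 e2 => maxn (maxn (reach w s e1) (reach w s e2))
                       (eval w s e1 * w + eval w s e2).+1
  end.

Inductive com : Type :=
| CSkip
| CSet of reg & expr
| CWord of expr & expr
| CBit of expr & expr & expr
| CSeq of com & com
| CIf of expr & com & com
| CWhile of expr & com.

(* [exec w c s t h s']: with word size [w], the program [c] started in [s]
   halts in [s'] after time [t], and all the bits of memory it accesses have
   addresses smaller than [h]. *)
Inductive exec (w : nat) : com -> state -> nat -> nat -> state -> Prop :=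
| ExecSkip s :
    exec w CSkip s 1 0 s
| ExecSet s r e :
    exec w (CSet r e) s (cost e).+1 (reach w s e) (set_reg s r (eval w s e))
| ExecWord s e1 e :
    exec w (CWord e1 e) s (cost e1 + cost e).+1
      (maxn (maxn (reach w s e1) (reach w s e)) ((eval w s e1).+1 * w))
      (set_word w s (eval w s e1) (eval w s e))
| ExecBit s e1 e2 e :
    exec w (CBit e1 e2 e) s (cost e1 + cost e2 + cost e).+1
      (maxn (maxn (maxn (reach w s e1) (reach w s e2)) (reach w s e))
            (eval w s e1 * w + eval w s e2).+1)
      (set_bit s (eval w s e1 * w + eval w s e2) (odd (eval w s e)))
| ExecSeq s s' s'' c1 c2 t1 t2 h1 h2 :
    exec w c1 s t1 h1 s' -> exec w c2 s' t2 h2 s'' ->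
    exec w (CSeq c1 c2) s (t1 + t2) (maxn h1 h2) s''
| ExecIfTrue s s' e c1 c2 t h :
    eval w s e != 0 -> exec w c1 s t h s' ->
    exec w (CIf e c1 c2) s ((cost e).+1 + t) (maxn (reach w s e) h) s'
| ExecIfFalse s s' e c1 c2 t h :
    eval w s e = 0 -> exec w c2 s t h s' ->
    exec w (CIf e c1 c2) s ((cost e).+1 + t) (maxn (reach w s e) h) s'
| ExecWhileTrue s s' s'' e c t1 t2 h1 h2 :
    eval w s e != 0 -> exec w c s t1 h1 s' ->
    exec w (CWhile e c) s' t2 h2 s'' ->
    exec w (CWhile e c) s ((cost e).+1 + (t1 + t2))
      (maxn (reach w s e) (maxn h1 h2)) s''
| ExecWhileFalse s e c :
    eval w s e = 0 ->
    exec w (CWhile e c) s (cost e).+1 (reach w s e) s.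

(* Word size of order log n.  The lower bound is explicit: a word must be able
   to hold [n], and the machine has words of at least two bits. *)
Definition theta_log (w : nat -> nat) : Prop :=
  exists c : nat, forall n : nat, 0 < n ->
    [/\ 1 < w n, n < 2 ^ w n & w n <= c * (trunc_log 2 n).+1].

(** * Algorithm A *)

Definition rlen : reg := @Ordinal nreg 0 isT.
Definition rn : reg := @Ordinal nreg 1 isT.
Definition ri : reg := @Ordinal nreg 2 isT.
Definition rj : reg := @Ordinal nreg 3 isT.
Definition rk : reg := @Ordinal nreg 4 isT.
Definition rm : reg := @Ordinal nreg 5 isT.
Definition rout : reg := @Ordinal nreg 6 isT.

Coercion EConst : nat >-> expr.
Coercion EReg : reg >-> expr.

Declare Scope ram_scope.
Delimit Scope ram_scope with ram.
Bind Scope ram_scope with expr com.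
Notation "e1 + e2" := (EOp Add e1 e2) : ram_scope.
Notation "e1 - e2" := (EOp Sub e1 e2) : ram_scope.
Notation "e1 * e2" := (EOp Mul e1 e2) : ram_scope.
Notation "e1 =? e2" := (EOp Eq e1 e2) (at level 70) : ram_scope.
Notation "e1 < e2" := (EOp Lt e1 e2) : ram_scope.
Notation "r <-- e" := (CSet r e) (at level 75) : ram_scope.
Notation "c1 ;; c2" := (CSeq c1 c2)
  (at level 85, right associativity) : ram_scope.

(* The divisor list D occupies the first words of memory: D[k][0] and D[k][1]
   are the words of addresses 2k and 2k + 1.  The rest of the memory, and the
   registers other than [rlen], which holds the length of D, are arbitrary. *)
Definition input_state (w : nat) (D : seq (nat * nat)) (s : state) : Prop :=
  regs s rlen = size D /\
  forall k, k < size D ->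
    get_word w s (2 * k) = (nth (0, 0) D k).1 /\
    get_word w s (2 * k + 1) = (nth (0, 0) D k).2.

Definition D0 (e : expr) : expr := EWord (2 * e)%ram.
Definition D1 (e : expr) : expr := EWord (2 * e + 1)%ram.

(* The bit vector A is stored immediately after the divisor list. *)
Definition get_A (e : expr) : expr := EBit (2 * rlen)%ram e.
Definition set_A (e v : expr) : com := CBit (2 * rlen)%ram e v.

(* [n] is read off the input as D[0][1]. *)
Definition algorithmA : com :=
  (rn <-- D1 0 ;;
   rk <-- 0 ;;
   rm <-- 0 ;;
   CWhile (rm < rn)
     (set_A rm 0 ;;
      rm <-- rm + 1) ;;
   ri <-- 1 ;;
   CWhile (ri < D0 (rlen - 1))
     (CIf (ri =? D0 rk) (rk <-- rk + 1) CSkip ;;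
      rj <-- ri ;;
      CWhile (rj < D1 rk)
        (set_A (ri * rj) 1 ;;
         rj <-- rj + 1) ;;
      ri <-- ri + 1) ;;
   rout <-- 0 ;;
   rm <-- 0 ;;
   CWhile (rm < rn)
     (rout <-- rout + get_A rm ;;
      rm <-- rm + 1))%ram.

(* Bits of memory up to the last one that belongs to the input or is accessed,
   plus the registers. *)
Definition space (w : nat) (D : seq (nat * nat)) (h : nat) : nat :=
  maxn (2 * size D * w) h + nreg * w.

(* Main.v *)
Require Import Defs.
From mathcomp Require Import all_boot order ssralg ssrnum ssrint rat zify finmap.
From mathcomp Require Import boolp classical_sets cardinality.

(** Correctness and cost both rest on the next listed divisor: for i below the
    largest divisor of n that is at most sqrt n, let d(i) be the smallest listed
    divisor above i.  When the outer loop reaches i, register k points at the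
    smallest listed divisor that is at least i, so after the test k points at
    d(i), and the inner loop marks the products i * j with i <= j < n / d(i).

    Correctness.  If m * n = a * b with a, b < n, put g = gcd(a, n), n = e * g
    and a = i * g.  Then e is prime to i and divides b = e * j, so m = i * j
    with i < e and j < g ([table_multiple_factor]).  One of e and g is a listed
    divisor, and after exchanging the two factors of m one may take i <= j and
    i < e <= g; then d(i) <= e gives j < g <= n / d(i), so m is marked.
    Conversely, m = i * j with i < d and j < n / d gives
    m * n = (i * (n / d)) * (j * d) with both factors below n
    ([table_multiple_marked]).  Marked products are below n, counters are at
    most n, and addresses in the divisor list are below max(n, 2), so with n
    fitting in a word no operation overflows ([list_len_fits]).

    Time.  Up to constants the main loop costs the sum of n / d(i) over i.  Group
    the i according to the interval (2^(u-1), 2^u] that contains d(i).  Only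
    intervals that contain a divisor occur, hence at most tau_plus n groups;
    in each one i < d(i) <= 2^u, so there are fewer than 2^u terms, each below
    2n / 2^u, and a group contributes at most 2n ([octave_sum],
    [sum_next_divisor]).  The two loops over the bit vector take time O(n), which
    is absorbed because the divisor 1 makes tau_plus n positive.

    Space.  The input takes two words for each of at most sqrt n divisors, which
    is O(sqrt n * log n) = O(n) bits ([size_mul_log]), and the bit vector n bits.

    The program is executed symbolically with a small total-correctness logic
    ([runs]) whose judgments bound the running time and the addresses accessed;
    [runs_for] handles all four loops. *)

Set Implicit Arguments.
Unset Strict Implicit.
Unset Printing Implicit Defensive.

Import Order.TTheory GRing.Theory Num.Theory.
Local Open Scope nat_scope.

(** * Ranks in sorted sequences *)

Lemma leq_nth_count (s : seq nat) (i k : nat) :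
  sorted ltn s -> k < size s -> (nth 0 s k <= i) = (k < count (leq^~ i) s).
Proof.
elim: s k => [|x s IH] // k /= xs_sorted.
have s_sorted := path_sorted xs_sorted.
have x_min : all (ltn x) s.
  by apply: order_path_min xs_sorted => ? ? ?; apply: ltn_trans.
have [x_le|x_gt] := leqP x i.
  by case: k => [|k] //= k_lt; rewrite add1n ltnS IH.
have -> : count (leq^~ i) s = 0.
  apply/eqP; rewrite -leqn0 leqNgt -has_count; apply/hasPn => y y_s.
  by have := allP x_min y y_s; rewrite /=; lia.
case: k => [|k] /= k_lt; first lia.
by have := allP x_min _ (mem_nth 0 (k_lt : k < size s)); rewrite /=; lia.
Qed.

(** The conditional increment of the counter in the program: passing i moves the
    rank by one exactly when i is the entry that the rank points at.  As 0 is
    also the default value of [nth], the case i = 0 has to be excluded. *)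
Lemma count_leq_step (s : seq nat) (i : nat) :
  sorted ltn s -> 0 < i ->
  count (leq^~ i) s = count (ltn^~ i) s + (nth 0 s (count (ltn^~ i) s) == i).
Proof.
move=> s_sorted i_gt0; elim: s s_sorted => [|x s IH] /= xs_sorted.
  by case: eqP => //; lia.
have x_min : all (ltn x) s.
  by apply: order_path_min xs_sorted => ? ? ?; apply: ltn_trans.
have [x_lt|x_ge] := ltnP x i.
  by rewrite ltnW //= !add1n /= IH ?addSn // (path_sorted xs_sorted).
have tail0 (P : pred nat) : (forall y, x < y -> ~~ P y) -> count P s = 0.
  move=> PF; apply/eqP; rewrite -leqn0 leqNgt -has_count; apply/hasPn => y y_s.
  exact: PF (allP x_min y y_s).
rewrite !tail0 /= => [|y|y]; lia.
Qed.

(** * The listed divisors *)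

Definition small_divisors (n : nat) : seq nat :=
  [seq d <- divisors n | d ^ 2 <= n].

Definition next_divisor (n i : nat) : nat :=
  nth 0 (small_divisors n) (count (leq^~ i) (small_divisors n)).

Definition top_divisor (n : nat) : nat :=
  nth 0 (small_divisors n) (size (small_divisors n)).-1.

Lemma small_divisors_sorted n : sorted ltn (small_divisors n).
Proof.
by apply: sorted_filter (sorted_divisors_ltn n) => ? ? ?; apply: ltn_trans.
Qed.

Lemma mem_small_divisors (n d : nat) :
  0 < n -> (d \in small_divisors n) = (d %| n) && (d ^ 2 <= n).
Proof. by move=> n_gt0; rewrite mem_filter -dvdn_divisors // andbC. Qed.

Lemma size_small_divisors_gt0 n : 0 < n -> 0 < size (small_divisors n).
Proof.
move=> n_gt0; have: 1 \in small_divisors n by rewrite mem_small_divisors ?dvd1n.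
by case: (small_divisors n).
Qed.

Lemma small_divisors_nth_leq n j k :
  j <= k -> k < size (small_divisors n) ->
  nth 0 (small_divisors n) j <= nth 0 (small_divisors n) k.
Proof.
move=> jk k_lt; have := small_divisors_sorted n.
rewrite ltn_sorted_uniq_leq => /andP[_ le_sorted].
by apply: (sorted_leq_nth leq_trans leqnn 0 le_sorted); rewrite ?inE; lia.
Qed.

Lemma small_divisors_nthP (n d : nat) : d \in small_divisors n ->
  exists2 k, k < size (small_divisors n) & nth 0 (small_divisors n) k = d.
Proof. by move/(nthP 0). Qed.

Lemma top_divisor_max (n d : nat) :
  d \in small_divisors n -> d <= top_divisor n.
Proof.
by case/small_divisors_nthP=> k k_lt <-; apply: small_divisors_nth_leq; lia.
Qed.

Lemma top_divisor_in n : 0 < n -> top_divisor n \in small_divisors n.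
Proof.
by move=> /size_small_divisors_gt0 sz; apply: mem_nth; rewrite ltn_predL.
Qed.

Lemma count_lt_size n i :
  0 < n -> i < top_divisor n ->
  count (leq^~ i) (small_divisors n) < size (small_divisors n).
Proof.
move=> /size_small_divisors_gt0 sz; rewrite /top_divisor ltnNge.
rewrite leq_nth_count ?small_divisors_sorted; lia.
Qed.

Lemma next_divisor_in n i :
  0 < n -> i < top_divisor n -> next_divisor n i \in small_divisors n.
Proof. by move=> n0 i_lt; apply/mem_nth/count_lt_size. Qed.

Lemma next_divisor_gt n i : 0 < n -> i < top_divisor n -> i < next_divisor n i.
Proof.
move=> n0 i_lt; rewrite ltnNge leq_nth_count ?small_divisors_sorted ?ltnn //.
exact: count_lt_size.
Qed.

Lemma next_divisor_min (n i d : nat) :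
  d \in small_divisors n -> i < d -> next_divisor n i <= d.
Proof.
case/small_divisors_nthP=> k k_lt <-.
rewrite ltnNge leq_nth_count ?small_divisors_sorted // -leqNgt => count_le.
exact: small_divisors_nth_leq.
Qed.

Lemma next_divisor_dvd n i :
  0 < n -> i < top_divisor n ->
  (next_divisor n i %| n) /\ next_divisor n i <= n %/ next_divisor n i.
Proof.
move=> n0 i_lt; have := next_divisor_in n0 i_lt.
rewrite mem_small_divisors // => /andP[dvd sq_le]; split=> //.
by rewrite leq_divRL ?(dvdn_gt0 n0 dvd) // -expnSr.
Qed.

(** * Marked bits and the multiplication table *)

(** What the outer loop has marked when it is about to treat row i. *)
Definition marked (n i m : nat) : Prop :=
  exists a b, [/\ 0 < a < i, a <= b < n %/ next_divisor n a & m = a * b].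

Lemma mem_mult_table N x :
  reflect (exists a b, [/\ 0 < a <= N, 0 < b <= N & x = a * b])
          (x \in mult_table N).
Proof.
apply: (iffP allpairsP) => [[[a b] [/=]]|[a [b [aN bN ->]]]].
  by rewrite !mem_iota => aN bN ->; exists a, b; split; lia.
by exists (a, b); split; rewrite ?mem_iota //=; lia.
Qed.

(** Divide out g = gcd(a, n): with n = e * g and a = i * g, the equation
    m * n = a * b becomes m * e = i * b where e is prime to i, so e divides b. *)
Lemma table_multiple_factor n m :
  0 < n -> 0 < m ->
  m * n \in mult_table n.-1 <->
  exists e g i j, [/\ e * g = n, 0 < i < e, 0 < j < g & m = i * j].
Proof.
move=> n0 m0; split=> [/mem_mult_table[a [b [a_in b_in def_mn]]]|].
  have g0 : 0 < gcdn a n by rewrite gcdn_gt0 n0 orbT.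
  have def_a : a = a %/ gcdn a n * gcdn a n by rewrite divnK ?dvdn_gcdl.
  have def_n : n = n %/ gcdn a n * gcdn a n by rewrite divnK ?dvdn_gcdr.
  have cop : coprime (a %/ gcdn a n) (n %/ gcdn a n).
    rewrite /coprime -(eqn_pmul2r g0) mul1n muln_gcdl.
    by rewrite -def_a -def_n.
  move: def_a def_n cop.
  move: (gcdn a n) g0 (a %/ _) (n %/ _) => g g0 i e def_a def_n cop.
  have def_me : m * e = i * b.
    apply/eqP; rewrite -(eqn_pmul2r g0) -mulnA -def_n def_mn {1}def_a.
    by apply/eqP; lia.
  have e_dvd_b : e %| b.
    rewrite -(Gauss_dvdr b (_ : coprime e i)) 1?coprime_sym //.
    by rewrite -def_me dvdn_mull.
  have e0 : 0 < e by case: e def_n {cop def_me e_dvd_b} => // def_n; lia.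
  have def_b := divnK e_dvd_b.
  exists e, g, i, (b %/ e); split=> //.
  - apply/andP; split; first by case: (i) def_a => //; lia.
    rewrite -(ltn_pmul2r g0) -def_a -def_n; lia.
  - apply/andP; split; first by case: (b %/ e) def_b => //; lia.
    rewrite -(ltn_pmul2r e0) def_b mulnC -def_n; lia.
  by apply/eqP; rewrite -(eqn_pmul2r e0) def_me -{1}def_b mulnA.
case=> e [g [i [j [def_n /andP[i0 ie] /andP[j0 jg] ->]]]].
apply/mem_mult_table; exists (i * g), (j * e).
have ig : i.+1 * g <= e * g by rewrite leq_mul2r ie orbT.
have je : e * j.+1 <= e * g by rewrite leq_mul2l jg orbT.
have ig0 : 0 < i * g by rewrite muln_gt0; lia.
have je0 : 0 < j * e by rewrite muln_gt0; lia.
split; [nia|nia|rewrite -def_n; lia].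
Qed.

(** The factorisation n = e * g supplies a listed divisor, the smaller of e and
    g; the next divisor after i is at most that one, hence its cofactor is large
    enough for the row of i to reach j. *)
Lemma table_multiple_marked n m :
  0 < n -> 0 < m ->
  m * n \in mult_table n.-1 <-> marked n (top_divisor n) m.
Proof.
move=> n0 m0; rewrite table_multiple_factor //; split; last first.
  case=> a [b [/andP[a0 a_lt] /andP[ab b_lt] ->]].
  have [d_dvd _] := next_divisor_dvd n0 a_lt.
  exists (next_divisor n a), (n %/ next_divisor n a), a, b.
  rewrite mulnC divnK // a0 b_lt next_divisor_gt //; split=> //; lia.
have main e g i j : e * g = n -> e <= g -> 0 < i -> i < e -> i <= j -> j < g ->
    marked n (top_divisor n) (i * j).
  move=> def_n eg i0 ie ij jg.
  have e_in : e \in small_divisors n.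
    rewrite mem_small_divisors // -{1 2}def_n dvdn_mulr //=.
    by rewrite expnS expn1 leq_mul.
  have i_lt : i < top_divisor n := leq_trans ie (top_divisor_max e_in).
  exists i, j; split; rewrite ?i0 ?ij //.
  apply: leq_trans jg _; rewrite leq_divRL; last first.
    exact: leq_ltn_trans (leq0n _) (next_divisor_gt n0 i_lt).
  by rewrite -[leqRHS]def_n [leqRHS]mulnC leq_mul2l next_divisor_min ?orbT.
case=> e [g [i [j [def_n /andP[i0 ie] /andP[j0 jg] ->]]]].
(* Exchanging (e, i) with (g, j) preserves all the constraints. *)
wlog ij : e g i j def_n i0 ie j0 jg / i <= j.
  move=> wl; have [ij|/ltnW ji] := leqP i j; first exact: (wl e g).
  by rewrite mulnC; apply: (wl g e); rewrite // mulnC.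
(* If e > g, then i <= j < g still allows g to play the part of e. *)
have [eg|ge] := leqP e g; first exact: (main e g).
by apply: (main g e); rewrite 1?mulnC //; lia.
Qed.

(** Bit 0 of the vector is never marked, in accordance with 0 not being a
    product of positive integers. *)
Lemma markedP n m : 0 < n -> m < n ->
  m * n \in mult_table n.-1 <-> marked n (top_divisor n) m.
Proof.
move=> n0; case: m => [|m] m_lt; last exact: table_multiple_marked.
split=> [/mem_mult_table[a [b [? ? def_0]]]|[a [b [? ? def_0]]]].
  by have: 0 < a * b by [rewrite muln_gt0; lia]; rewrite -def_0.
have: 0 < a * b by rewrite muln_gt0; lia.
by rewrite -def_0.
Qed.

(** The multiples m * n are counted for 1 <= m <= n but the bit vector is indexed
    by 0 <= m < n; the two ends agree because neither 0 nor n * n is in the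
    table. *)
Lemma delta_sum n : 0 < n ->
  delta n = \sum_(0 <= m < n) (m * n \in mult_table n.-1).
Proof.
move=> n0; rewrite /delta undup_id; last first.
  apply/filter_uniq; rewrite map_inj_uniq ?iota_uniq // => x y /eqP.
  by rewrite eqn_pmul2r // => /eqP.
rewrite size_filter count_map.
have not_table m : m = 0 \/ m = n -> (m * n \in mult_table n.-1) = false.
  move=> m0n; apply/negP => /mem_mult_table[a [b [a_in b_in def_x]]].
  have ab0 : 0 < a * b by rewrite muln_gt0; lia.
  have ab : a * b <= n.-1 * n.-1 by apply: leq_mul; lia.
  by case: m0n def_x => ->; nia.
rewrite -sum1_count big_mkcond /=.
have -> : iota 1 n = index_iota 1 n.+1 by rewrite /index_iota subSS subn0.
rewrite big_nat_recr //= not_table ?addn0; last by right.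
rewrite [RHS]big_ltn // not_table; last by left.
by apply: eq_bigr => m _; case: (_ \in _).
Qed.

(** * Dyadic intervals that contain a divisor *)

(** The index u stands for the interval (2^(u-1), 2^u], i.e. for k = u - 1 in
    the definition of [tau_plus]. *)
Definition octaves (n : nat) : seq nat :=
  undup [seq up_log 2 d | d <- divisors n].

(** The lower bound 2^(p-1) < d is doubled so that p = 0 needs no case. *)
Lemma up_log2_eq (d p : nat) : 0 < d ->
  (2 ^ p < d * 2) && (d <= 2 ^ p) = (p == up_log 2 d).
Proof.
move=> d0; apply/andP/eqP => [[lt_d d_le]|->].
  apply/eqP; rewrite eqn_leq up_log_min // andbT.
  case: p lt_d {d_le} => // p; rewrite expnSr ltn_pmul2r // => lt_d.
  rewrite ltnNge; apply/negP => le_p.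
  have := leq_trans (up_logP d (isT : 1 < 2)) (leq_pexp2l (isT : 0 < 2) le_p).
  lia.
split; last exact: up_logP.
have [->|d_neq1] := eqVneq d 1; first by rewrite up_log1.
have d1 : 1 < d by lia.
have := up_log_gtn (isT : 1 < 2) d1.
have: 0 < up_log 2 d by rewrite up_log_gt0.
by case: (up_log 2 d) => // u _; rewrite expnSr ltn_pmul2r.
Qed.

Lemma dyadic_interval_eq (d : nat) (k : int) : 0 < d ->
  ((2%:Q ^ k < d%:R) && (d%:R <= 2%:Q ^ (k + 1)))%R = (k + 1 == up_log 2 d)%R.
Proof.
move=> d0; have -> : (2%:Q ^ k < d%:R = (2%:Q ^ (k + 1) < (d * 2)%:R))%R.
  by rewrite exprzDr ?unitfE // expr1z natrM ltr_pM2r.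
case: (k + 1)%R => p.
  have -> : (2%:Q ^ p = (2 ^ p)%:R)%R by rewrite natrX.
  by rewrite ltr_nat ler_nat up_log2_eq.
rewrite andbC NegzE; case: (boolP (d%:R <= _)%R) => // d_le.
have: (2%:Q ^ (- p.+1%:Z) < 1)%R.
  by rewrite -exprnN invf_lt1 ?exprn_gt0 // exprn_egt1.
by move/(le_lt_trans d_le); rewrite ltrn1; lia.
Qed.

(** The set of exponents in [tau_plus] has to be shown finite, since [fset_set]
    is empty otherwise; it is the shifted image of [octaves n]. *)
Lemma size_octaves n : 0 < n -> size (octaves n) <= tau_plus n.
Proof.
move=> n0; rewrite /tau_plus.
set S := (X in fset_set X).
have SE : S = [set` [seq (u%:Z - 1)%R | u <- octaves n]]%classic.
  apply/seteqP; split=> k /=.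
    rewrite /S/= /tau size_filter -has_count => /hasP[d d_in].
    have d0 : 0 < d by move: d_in; rewrite -dvdn_divisors // => /(dvdn_gt0 n0).
    rewrite dyadic_interval_eq // => /eqP def_k.
    apply/mapP; exists (up_log 2 d); first by rewrite mem_undup map_f.
    by rewrite -def_k addrK.
  case/mapP=> u; rewrite mem_undup => /mapP[d d_in ->] ->.
  have d0 : 0 < d by move: d_in; rewrite -dvdn_divisors // => /(dvdn_gt0 n0).
  rewrite /S /= /tau size_filter -has_count; apply/hasP; exists d => //.
  by rewrite dyadic_interval_eq // subrK.
rewrite -(size_map (fun u : nat => (u%:Z - 1)%R)).
apply: uniq_leq_size.
  by rewrite map_inj_uniq ?undup_uniq // => x y /addIr[].
by move=> k k_in; rewrite in_fset_set SE ?inE //; apply: finite_seq.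
Qed.

Lemma tau_plus_gt0 n : 0 < n -> 0 < tau_plus n.
Proof.
move=> n0; apply: leq_trans (size_octaves n0).
have: up_log 2 1 \in octaves n by rewrite mem_undup map_f // -dvdn_divisors.
by case: (octaves n).
Qed.

(** * Arithmetic bounds on time and space *)

(** At most 2^u indices are below a divisor of octave u, and each contributes at
    most 2n / 2^u. *)
Lemma octave_sum n u : 0 < n ->
  \sum_(1 <= i < top_divisor n | up_log 2 (next_divisor n i) == u)
     n %/ next_divisor n i <= 2 * n.
Proof.
move=> n0; rewrite big_seq_cond.
pose P i := (i \in index_iota 1 (top_divisor n)) &&
  (up_log 2 (next_divisor n i) == u).
rewrite -/(P _).
have bounds i : P i -> n %/ next_divisor n i <= (2 * n) %/ 2 ^ u /\ i < 2 ^ u.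
  rewrite /P mem_index_iota => /andP[/andP[i0 i_lt] /eqP def_u].
  have i_lt_d := next_divisor_gt n0 i_lt.
  have d0 : 0 < next_divisor n i by lia.
  have := up_log2_eq u d0; rewrite def_u eqxx => /andP[u_lt d_le].
  split; last exact: leq_trans i_lt_d d_le.
  rewrite leq_divRL ?expn_gt0 //.
  have := leq_divM n (next_divisor n i).
  nia.
apply: (@leq_trans (\sum_(1 <= i < top_divisor n | P i) (2 * n) %/ 2 ^ u)).
  by apply: leq_sum => i /bounds[].
rewrite big_const_seq iter_addn_0.
apply: leq_trans (leq_divM (2 * n) (2 ^ u)).
rewrite leq_mul2l; apply/orP; right.
rewrite -size_filter -[leqRHS](size_iota 0); apply: uniq_leq_size.
  by rewrite filter_uniq // iota_uniq.
by move=> i; rewrite mem_filter mem_iota => /andP[/bounds[_ ->]].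
Qed.

Lemma sum_next_divisor n : 0 < n ->
  \sum_(1 <= i < top_divisor n) n %/ next_divisor n i <= 2 * (n * tau_plus n).
Proof.
move=> n0; pose u i := up_log 2 (next_divisor n i).
have -> : \sum_(1 <= i < top_divisor n) n %/ next_divisor n i =
    \sum_(v <- octaves n) \sum_(1 <= i < top_divisor n | u i == v)
       n %/ next_divisor n i.
  rewrite (exchange_big_dep predT) //=; apply: eq_big_seq => i.
  rewrite mem_index_iota => /andP[_ i_lt].
  have u_in : u i \in octaves n.
    rewrite mem_undup (map_f (up_log 2)) // -dvdn_divisors //.
    by case: (next_divisor_dvd n0 i_lt).
  rewrite big_const_seq iter_addn_0 -[LHS]muln1; congr muln.
  rewrite (@eq_count _ _ (pred1 (u i))) => [|v]; last by rewrite /= eq_sym.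
  by rewrite count_uniq_mem ?undup_uniq // u_in.
apply: (@leq_trans (\sum_(v <- octaves n) 2 * n)).
  by apply: leq_sum => v _; apply: octave_sum.
rewrite big_const_seq iter_addn_0 count_predT mulnA leq_mul2l.
by rewrite size_octaves ?orbT.
Qed.

Lemma size_small_divisors_top n : 0 < n ->
  size (small_divisors n) <= top_divisor n.
Proof.
move=> n0; rewrite -[leqRHS](size_iota 1); apply: uniq_leq_size.
  by rewrite filter_uniq ?divisors_uniq.
move=> d d_in; rewrite mem_iota add1n ltnS top_divisor_max // andbT.
by move: d_in; rewrite mem_small_divisors // => /andP[/(dvdn_gt0 n0)].
Qed.

Lemma top_divisor_sq n : 0 < n -> top_divisor n ^ 2 <= n.
Proof.
by move=> n0; have := top_divisor_in n0; rewrite mem_small_divisors // => /andP[].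
Qed.

Lemma sq_leq_expn2 L : L.+1 ^ 2 <= 4 * 2 ^ L.
Proof.
have base : [/\ 1 ^ 2 <= 4 * 2 ^ 0, 2 ^ 2 <= 4 * 2 ^ 1 & 3 ^ 2 <= 4 * 2 ^ 2] by [].
case: L => [|[|]]; try by case: base.
by elim=> [|L IH]; [case: base | rewrite [in leqRHS]expnS; lia].
Qed.

(** Compare squares: the first factor is at most sqrt n, and the square of the
    second at most 4n by [sq_leq_expn2]. *)
Lemma size_mul_log n : 0 < n ->
  size (small_divisors n) * (trunc_log 2 n).+1 <= 2 * n.
Proof.
move=> n0; rewrite -leq_sqr !expnMn.
have := trunc_logP (isT : 1 < 2) n0; have := sq_leq_expn2 (trunc_log 2 n).
have := size_small_divisors_top n0; have := top_divisor_sq n0.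
move: (trunc_log 2 n).+1 (2 ^ trunc_log 2 n) (top_divisor n) (size _) => L p t l.
move=> tn lt L4 pn.
have l2 : l ^ 2 <= n by apply: leq_trans tn; rewrite leq_sqr.
have L2 : L ^ 2 <= 4 * n by lia.
have := leq_mul l2 L2; lia.
Qed.

Lemma trunc_log_lt n : 0 < n -> (trunc_log 2 n).+1 <= n.
Proof.
move=> n0; apply: leq_trans (trunc_logP (isT : 1 < 2) n0); exact: ltn_expl.
Qed.

(** * Total correctness with time and space bounds *)

(** The postcondition is a function on states so that the judgment for the rest
    of a program can itself serve as a postcondition ([runs_seq]). *)
Definition runs (w : nat) (c : com) (s : state) (T H : nat)
    (Q : state -> Prop) : Prop :=
  exists t h s', [/\ exec w c s t h s', t <= T, h <= H & Q s'].

Section Runs.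
Variables (w H : nat).
Implicit Types (s : state) (e : expr) (c : com) (Q : state -> Prop).

Lemma runs_weaken c s T T' Q Q' :
  T <= T' -> (forall s', Q s' -> Q' s') ->
  runs w c s T H Q -> runs w c s T' H Q'.
Proof.
move=> le_T QQ' [t [h [s' [ex t_le h_le /QQ' Qs']]]].
by exists t, h, s'; split=> //; apply: leq_trans le_T.
Qed.

Lemma runs_skip s T Q : 0 < T -> Q s -> runs w CSkip s T H Q.
Proof. by move=> T0 Qs; exists 1, 0, s; split=> //; apply: ExecSkip. Qed.

Lemma runs_set s r e T Q :
  cost e < T -> reach w s e <= H -> Q (set_reg s r (eval w s e)) ->
  runs w (CSet r e) s T H Q.
Proof. by move=> le_T le_H Qs; do 3!eexists; split; first exact: ExecSet. Qed.

Lemma runs_bit s e1 e2 e T Q :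
  cost e1 + cost e2 + cost e < T ->
  maxn (maxn (reach w s e1) (reach w s e2)) (reach w s e) <= H ->
  eval w s e1 * w + eval w s e2 < H ->
  Q (set_bit s (eval w s e1 * w + eval w s e2) (odd (eval w s e))) ->
  runs w (CBit e1 e2 e) s T H Q.
Proof.
move=> le_T le_H lt_H Qs; do 3!eexists; split; first exact: ExecBit.
- exact: le_T.
- by rewrite geq_max le_H.
exact: Qs.
Qed.

Lemma runs_seq c1 c2 s T1 T2 Q :
  runs w c1 s T1 H (fun s' => runs w c2 s' T2 H Q) ->
  runs w (CSeq c1 c2) s (T1 + T2) H Q.
Proof.
case=> [t1 [h1 [s1 [ex1 t1_le h1_le [t2 [h2 [s2 [ex2 t2_le h2_le Qs]]]]]]]].
exists (t1 + t2), (maxn h1 h2), s2; split=> //; first exact: ExecSeq ex2.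
  exact: leq_add.
by rewrite geq_max h1_le.
Qed.

Lemma runs_seq_post c1 c2 s T1 T2 Q1 Q :
  runs w c1 s T1 H Q1 -> (forall s', Q1 s' -> runs w c2 s' T2 H Q) ->
  runs w (CSeq c1 c2) s (T1 + T2) H Q.
Proof. by move=> runs1 runs2; apply/runs_seq/(runs_weaken (leqnn _) runs2). Qed.

Lemma runs_if e c1 c2 s T Q :
  cost e < T -> reach w s e <= H ->
  runs w (if eval w s e == 0 then c2 else c1) s (T - (cost e).+1) H Q ->
  runs w (CIf e c1 c2) s T H Q.
Proof.
move=> lt_T le_H; case: eqP => [e0|/eqP e0] [t [h [s' [ex t_le h_le Qs]]]].
all: exists ((cost e).+1 + t), (maxn (reach w s e) h), s'.
all: split; rewrite ?geq_max ?le_H //; try by constructor.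
all: lia.
Qed.

(** The loops count from a to b: [I x] holds when the guard is evaluated with
    counter x, and the guard is true exactly when x < b, so the number of
    iterations is known in advance. *)
Lemma runs_for e c (I : nat -> state -> Prop) (T : nat -> nat) a b :
  (forall x s, a <= x <= b -> I x s ->
     reach w s e <= H /\ eval w s e = (x < b)) ->
  (forall x s, a <= x < b -> I x s -> runs w c s (T x) H (I x.+1)) ->
  a <= b -> forall s, I a s ->
  runs w (CWhile e c) s (\sum_(a <= x < b) ((cost e).+1 + T x) + (cost e).+1) H
       (I b).
Proof.
move=> guard body; move def_k: (b - a) => k.
elim: k a def_k guard body => [|k IH] a def_k guard body le_ab s Is.
  have def_b : a = b by lia.
  rewrite def_b in guard Is *.
  have [le_H e_eq] := guard b s ltac:(lia) Is.
  rewrite big_geq // add0n; do 3!eexists; split; last exact: Is.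
  - by apply: ExecWhileFalse; rewrite e_eq ltnn.
  - by [].
  - exact: le_H.
have lt_ab : a < b by lia.
have [le_H e_eq] := guard a s ltac:(lia) Is.
have [t1 [h1 [s1 [ex1 t1_le h1_le Is1]]]] := body a s ltac:(lia) Is.
have [|||] := IH a.+1 _ _ _ lt_ab s1 Is1.
- lia.
- by move=> x s2 x_in; apply: guard; lia.
- by move=> x s2 x_in; apply: body; lia.
move=> t2 [h2 [s2 [ex2 t2_le h2_le Is2]]].
exists ((cost e).+1 + (t1 + t2)), (maxn (reach w s e) (maxn h1 h2)), s2.
split=> //.
- by apply: ExecWhileTrue ex1 ex2; rewrite e_eq lt_ab.
- rewrite big_ltn // -!addnA !leq_add2l; exact: leq_add.
by rewrite !geq_max le_H h1_le.
Qed.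

End Runs.

(** * The state of the program *)

Definition fits (w n : nat) : Prop := [/\ 1 < w, 0 < n & n < 2 ^ w].

Definition list_len (n : nat) : nat := size (small_divisors n).

(** The part of the state that the program never changes once n is loaded. *)
Definition frame (w n : nat) (s : state) : Prop :=
  [/\ regs s rlen = list_len n, regs s rn = n &
      forall k, k < list_len n ->
        get_word w s (2 * k) = nth 0 (small_divisors n) k /\
        get_word w s (2 * k + 1) = n %/ nth 0 (small_divisors n) k].

Definition vec (w n : nat) (s : state) (m : nat) : bool :=
  Defs.mem s (2 * list_len n * w + m).

(** Addresses in the divisor list do not overflow.  From the square of the
    length being at most n, twice the length is at most n unless n < 4, when the
    length is 1; this is where words of two bits matter. *)
Lemma list_len_fits w n : fits w n -> 2 * list_len n < 2 ^ w.
Proof.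
case=> w1 n0 n_lt; apply: (@leq_trans (maxn n 2).+1); last first.
  by rewrite gtn_max n_lt (@ltn_exp2l 2 1 w).
have := top_divisor_sq n0; have := size_small_divisors_top n0.
rewrite -/(list_len n); move: (list_len n) (top_divisor n) => l t; nia.
Qed.

Lemma nth_divisor_list n k : k < list_len n ->
  nth (0, 0) (divisor_list n) k =
  (nth 0 (small_divisors n) k, n %/ nth 0 (small_divisors n) k).
Proof. by move=> k_lt; rewrite (nth_map 0). Qed.

Lemma get_word_set_bit w s p b a : a.+1 * w <= p ->
  get_word w (set_bit s p b) a = get_word w s a.
Proof.
move=> le_p; apply: eq_bigr => i _ /=; case: eqP => // def_p.
by have := ltn_ord i; lia.
Qed.

Lemma frame_set_bit w n s p b : 2 * list_len n * w <= p ->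
  frame w n s -> frame w n (set_bit s p b).
Proof.
move=> le_p [len rn_n D]; split=> // k k_lt.
have [D0k D1k] := D k k_lt.
by rewrite !get_word_set_bit //; apply: leq_trans le_p; rewrite leq_mul2r; lia.
Qed.

Section Evaluation.
Variables (w n : nat) (s : state).
Hypotheses (wn : fits w n) (F : frame w n s).

Lemma small_const : (0 %% 2 ^ w = 0) * (1 %% 2 ^ w = 1) * (2 %% 2 ^ w = 2).
Proof.
case: wn => w1 _ _; have w4 : 2 ^ 2 <= 2 ^ w by rewrite leq_exp2l.
by rewrite mod0n !modn_small //; lia.
Qed.

Lemma eval_D0 e k : eval w s e = k -> k < list_len n ->
  eval w s (D0 e) = nth 0 (small_divisors n) k.
Proof.
move=> ek k_lt; case: F => _ _ /(_ k k_lt) [<- _] /=.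
have := list_len_fits wn; rewrite ek !small_const => l_lt.
by rewrite modn_small //; lia.
Qed.

Lemma eval_D1 e k : eval w s e = k -> k < list_len n ->
  eval w s (D1 e) = n %/ nth 0 (small_divisors n) k.
Proof.
move=> ek k_lt; case: F => _ _ /(_ k k_lt) [_ <-] /=.
have := list_len_fits wn; rewrite ek !small_const => l_lt.
rewrite [2 * k %% _]modn_small ?modn_small //; lia.
Qed.

Lemma reach_D0 e k : eval w s e = k -> k < list_len n -> reach w s e = 0 ->
  reach w s (D0 e) <= 2 * list_len n * w.
Proof.
move=> ek k_lt re /=; have := list_len_fits wn.
rewrite re ek !small_const !max0n => l_lt.
by rewrite modn_small ?leq_mul2r; lia.
Qed.

Lemma reach_D1 e k : eval w s e = k -> k < list_len n -> reach w s e = 0 ->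
  reach w s (D1 e) <= 2 * list_len n * w.
Proof.
move=> ek k_lt re /=; have := list_len_fits wn.
rewrite re ek !small_const !max0n => l_lt.
by rewrite [2 * k %% _]modn_small ?modn_small ?leq_mul2r; lia.
Qed.

Lemma eval_A_base : eval w s (2 * rlen)%ram = 2 * list_len n.
Proof.
case: F => len _ _ /=; rewrite len !small_const modn_small //.
exact: list_len_fits.
Qed.

End Evaluation.

(** * The loops of the program *)

Definition horizon (w n : nat) : nat := 2 * list_len n * w + n.

Definition clear_loop : com :=
  CWhile (rm < rn) (set_A rm 0 ;; rm <-- rm + 1)%ram.
Definition row_loop : com :=
  CWhile (rj < D1 rk) (set_A (ri * rj) 1 ;; rj <-- rj + 1)%ram.
Definition mark_loop : com :=
  CWhile (ri < D0 (rlen - 1))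
    (CIf (ri =? D0 rk) (rk <-- rk + 1) CSkip ;; rj <-- ri ;; row_loop ;;
     ri <-- ri + 1)%ram.
Definition weigh_loop : com :=
  CWhile (rm < rn) (rout <-- rout + get_A rm ;; rm <-- rm + 1)%ram.

(* Otherwise simplification would expose the memory of an updated state. *)
Arguments vec : simpl never.

Lemma vec_set_reg w n s r v m : vec w n (set_reg s r v) m = vec w n s m.
Proof. by []. Qed.

Lemma vec_set_bit w n s p b m :
  vec w n (set_bit s (2 * list_len n * w + p) b) m =
  if m == p then b else vec w n s m.
Proof. by rewrite /vec /= eqn_add2l. Qed.

Section Loops.
Variables (w n : nat).
Hypothesis wn : fits w n.
Local Notation H := (horizon w n).
Local Notation Runs := (fun c s T Q => runs w c s T H Q).
Local Notation ds := (small_divisors n).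

Lemma n_gt0 : 0 < n. Proof. by case: wn. Qed.

Lemma lt_word x : x <= n -> x < 2 ^ w.
Proof. by case: wn => _ _ n_lt x_le; apply: leq_ltn_trans n_lt. Qed.

Lemma runs_set_A e v s m T Q :
  frame w n s -> eval w s e = m -> m < n ->
  reach w s e = 0 -> reach w s v = 0 ->
  4 + cost e + cost v <= T ->
  (frame w n (set_bit s (2 * list_len n * w + m) (odd (eval w s v))) ->
   Q (set_bit s (2 * list_len n * w + m) (odd (eval w s v)))) ->
  Runs (set_A e v) s T Q.
Proof.
move=> F em m_lt re rv T_le Qs.
have base := eval_A_base wn F.
apply: runs_bit.
- by rewrite /=; lia.
- by rewrite re rv.
- by rewrite base em /horizon ltn_add2l.
rewrite base em; apply: Qs; apply: frame_set_bit F; exact: leq_addr.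
Qed.

Lemma clear_runs s :
  frame w n s -> regs s rk = 0 -> regs s rm = 0 ->
  Runs clear_loop s (14 * n + 4)
    (fun s' => [/\ frame w n s', regs s' rk = 0 &
                   forall m, m < n -> ~~ vec w n s' m]).
Proof.
move=> F rk0 rm0.
pose I x s := [/\ frame w n s, regs s rk = 0, regs s rm = x &
                  forall m, m < x -> ~~ vec w n s m].
apply: (@runs_weaken _ _ _ _ _ _ (I n)); last first.
- apply: (@runs_for _ _ _ _ I (fun=> 10) 0 n) => //.
  + by move=> x s1 _ [[_ rn_n _] _ rm_x _] /=; rewrite rn_n rm_x.
  move=> x s1 x_in [F1 rk1 rm_x clear]; apply: (@runs_seq _ _ _ _ _ 6 4).
  apply: (@runs_set_A _ _ _ x) => // F2.
  apply: runs_set => //; split=> //=.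
    by rewrite rm_x (small_const wn) modn_small ?addn1 // lt_word.
  move=> m m_lt; rewrite vec_set_reg vec_set_bit.
  by case: eqP => [_|m_neq]; rewrite ?(small_const wn) // clear //; lia.
- by move=> s' [].
by rewrite sum_nat_const_nat /=; lia.
Qed.

(** With i < d = d(i) and j < n / d, the product i * j stays below n, so neither
    the multiplication nor the write to the bit vector overflows.  Here and in
    [mark_runs] the time bounds are rounded up from the unit costs of guard and
    body. *)
Lemma row_runs s i :
  0 < i < top_divisor n -> frame w n s -> regs s ri = i -> regs s rj = i ->
  regs s rk = count (leq^~ i) ds ->
  (forall m, m < n -> vec w n s m <-> marked n i m) ->
  Runs row_loop s (30 * (n %/ next_divisor n i) + 30)
    (fun s' => [/\ frame w n s', regs s' ri = i,
       regs s' rk = count (leq^~ i) ds &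
       forall m, m < n -> vec w n s' m <-> marked n i.+1 m]).
Proof.
move=> /andP[i0 i_lt] F ri_i rj_i rk_i Vi.
have k_lt := count_lt_size n_gt0 i_lt.
have [d_dvd d_le] := next_divisor_dvd n_gt0 i_lt.
have i_lt_d := next_divisor_gt n_gt0 i_lt.
pose I j s := [/\ frame w n s, regs s ri = i /\ regs s rj = j,
  regs s rk = count (leq^~ i) ds &
  forall m, m < n -> vec w n s m <->
    marked n i m \/ exists2 b, i <= b < j & m = i * b].
have lt_n j : j < n %/ next_divisor n i -> i * j < n.
  by have := divnK d_dvd; nia.
have n_div : n %/ next_divisor n i <= n := leq_div _ _.
apply: (@runs_weaken _ _ _ _ _ _ (I (n %/ next_divisor n i))); last first.
- apply: (@runs_for _ _ _ _ I (fun=> 12) i) => //.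
  + move=> j s1 _ [F1 [_ rj_j] rk_k _].
    have ek : eval w s1 rk = count (leq^~ i) ds by [].
    split; last first.
      rewrite -[LHS]/(regs s1 rj < eval w s1 (D1 rk) : nat).
      by rewrite (eval_D1 wn F1 ek k_lt) rj_j.
    rewrite -[reach _ _ _]/(maxn 0 (reach w s1 (D1 rk))) max0n.
    by apply: (leq_trans (reach_D1 wn ek k_lt _)); rewrite ?leq_addr.
  + move=> j s1 j_in [F1 [ri1 rj1] rk1 V1]; apply: (@runs_seq _ _ _ _ _ 8 4).
    have ij_lt : i * j < n by apply: lt_n; lia.
    apply: (@runs_set_A _ _ _ (i * j)) => // [|F2].
      by rewrite /= ri1 rj1 modn_small // lt_word // ltnW.
    apply: runs_set => //; split=> //=.
      split=> //; rewrite rj1 (small_const wn) modn_small ?addn1 // lt_word //.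
      lia.
    move=> m m_lt; rewrite vec_set_reg vec_set_bit.
    rewrite (small_const wn); case: eqP => [->|m_neq].
      by split=> // _; right; exists j => //; lia.
    rewrite V1 //; split=> [[|[b b_in def_m]]|[|[b b_in def_m]]]; try by left.
      by right; exists b => //; lia.
    right; exists b => //; case: (eqVneq b j) => [def_b|]; last lia.
    by case: m_neq; rewrite def_m def_b.
  + by apply: leq_trans d_le; exact: ltnW.
  split=> // m m_lt; rewrite Vi //; split; first by left.
  by case=> // -[b]; lia.
- move=> s' [F' [ri' _] rk' V']; split=> // m m_lt; rewrite V' //; split.
    case=> [[a [b [a_in b_in def_m]]]|[b b_in def_m]].
      by exists a, b; split=> //; lia.
    by exists i, b; split=> //; lia.
  case=> a [b [a_in b_in def_m]]; have [def_a|a_neq] := eqVneq a i.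
    by right; exists b; rewrite -?def_a.
  by left; exists a, b; split=> //; lia.
by rewrite sum_nat_const_nat /=; nia.
Qed.

(** The counter k is the rank of i in the list at the start of row i.  It never
    passes the last entry, since i is below that entry. *)
Lemma mark_runs s :
  frame w n s -> regs s rk = 0 -> regs s ri = 1 ->
  (forall m, m < n -> ~~ vec w n s m) ->
  Runs mark_loop s
    (\sum_(1 <= i < top_divisor n) (80 + 30 * (n %/ next_divisor n i)) + 20)
    (fun s' => frame w n s' /\
       forall m, m < n -> vec w n s' m <-> marked n (top_divisor n) m).
Proof.
move=> F rk0 ri1 V0.
have l0 : 0 < list_len n := size_small_divisors_gt0 n_gt0.
have sd0 := small_divisors_sorted n.
have ds_pos d : d \in ds -> 0 < d.
  by rewrite mem_small_divisors ?n_gt0 // => /andP[/(dvdn_gt0 n_gt0)].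
pose I i s := [/\ frame w n s, regs s ri = i,
  regs s rk = count (ltn^~ i) ds &
  forall m, m < n -> vec w n s m <-> marked n i m].
apply: (@runs_weaken _ _ _ _ _ _ (I (top_divisor n))); last first.
- apply: (@runs_for _ _ _ _ I
    (fun i => 60 + 30 * (n %/ next_divisor n i)) 1) => //.
  + move=> i s1 _ [F1 ri_i _ _].
    have last_l : eval w s1 (rlen - 1)%ram = (list_len n).-1.
      have := list_len_fits wn.
      case: F1 => len _ _ /=; rewrite len (small_const wn).
      move=> l_fits; have -> : list_len n + 2 ^ w - 1 = (list_len n).-1 + 2 ^ w.
        lia.
      rewrite modnDr modn_small //; lia.
    have last_lt : (list_len n).-1 < list_len n by rewrite ltn_predL.
    split; last first.
      rewrite -[LHS]/(regs s1 ri < eval w s1 (D0 (rlen - 1)%ram) : nat).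
      by rewrite (eval_D0 wn F1 last_l last_lt) ri_i.
    rewrite -[reach _ _ _]/(maxn 0 (reach w s1 (D0 (rlen - 1)%ram))) max0n.
    by apply: (leq_trans (reach_D0 wn last_l last_lt _)); rewrite ?leq_addr.
  + move=> i s1 /andP[i0 i_lt] [F1 ri_i rk_i V1].
    have k_lt : count (ltn^~ i) ds < list_len n.
      apply: leq_ltn_trans (count_lt_size n_gt0 i_lt).
      by apply: sub_count => x /=; exact: ltnW.
    have ek : eval w s1 rk = count (ltn^~ i) ds by [].
    pose d := next_divisor n i.
    apply: (@runs_weaken _ _ _ _
      (20 + (2 + ((30 * (n %/ d) + 30) + 4))) _ (I i.+1)) => //.
      by rewrite -/d; lia.
    apply: (@runs_seq_post _ _ _ _ _ _ _ (fun s' =>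
       [/\ frame w n s', regs s' ri = i, regs s' rk = count (leq^~ i) ds &
        forall m, m < n -> vec w n s' m <-> marked n i m])).
      have De := eval_D0 wn F1 ek k_lt.
      apply: runs_if => //.
        rewrite -[reach _ _ _]/(maxn 0 (reach w s1 (D0 rk))) max0n.
        by apply: (leq_trans (reach_D0 wn ek k_lt _)); rewrite ?leq_addr.
      rewrite -[eval _ _ _]/((regs s1 ri == eval w s1 (D0 rk)) : nat) De ri_i.
      rewrite [i == _]eq_sym; have := count_leq_step sd0 i0.
      case: eqP => _ /= def_count; last first.
        by apply: runs_skip => //; rewrite /= rk_i def_count addn0.
      apply: runs_set => //; split=> //=.
      rewrite rk_i def_count (small_const wn) modn_small //.
      by have := list_len_fits wn; lia.
    move=> s2 [F2 ri2 rk2 V2]; apply/runs_seq/runs_set => //.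
    apply: (runs_seq_post (row_runs _ _ _ _ _ _)); rewrite ?i0 //.
    move=> s3 [F3 ri3 rk3 V3]; apply: runs_set => //; split=> //=.
    rewrite ri3 (small_const wn) modn_small ?addn1 // lt_word //.
    have := top_divisor_sq n_gt0; nia.
  + have := top_divisor_max (_ : 1 \in ds); apply.
    by rewrite mem_small_divisors ?n_gt0 ?dvd1n.
  split=> //.
    rewrite rk0; apply/esym/eqP; rewrite -leqn0 leqNgt -has_count.
    by apply/hasPn => d /ds_pos d_gt0; rewrite -leqNgt.
  move=> m m_lt; split=> [|[a [b [a_in]]]]; last lia.
  by rewrite (negbTE (V0 m m_lt)).
- by move=> s' [].
rewrite leq_add //; apply: leq_sum => i _ /=; lia.
Qed.

Lemma weigh_runs s (A : nat -> bool) :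
  frame w n s -> regs s rm = 0 -> regs s rout = 0 ->
  (forall m, m < n -> vec w n s m = A m) ->
  Runs weigh_loop s (20 * n + 4)
    (fun s' => regs s' rout = \sum_(0 <= m < n) A m).
Proof.
move=> F rm0 rout0 V.
pose I x s := [/\ frame w n s, regs s rm = x,
  regs s rout = \sum_(0 <= m < x) A m & forall m, m < n -> vec w n s m = A m].
apply: (@runs_weaken _ _ _ _ _ _ (I n)); last first.
- apply: (@runs_for _ _ _ _ I (fun=> 16) 0 n) => //.
  + by move=> x s1 _ [[_ rn_n _] rm_x _ _] /=; rewrite rn_n rm_x.
  + move=> x s1 x_in [F1 rm_x rout_x V1]; apply: (@runs_seq _ _ _ _ _ 12 4).
    have base := eval_A_base wn F1.
    have bit : eval w s1 (get_A rm) = A x.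
      rewrite -V1 /vec; last lia.
      rewrite -[LHS]/(Defs.mem s1
        (eval w s1 (2 * rlen)%ram * w + regs s1 rm) : nat).
      by rewrite base rm_x.
    have sum_le : \sum_(0 <= m < x) A m <= x.
      rewrite -[leqRHS]muln1 -[x in x * 1]subn0 -sum_nat_const_nat.
      by apply: leq_sum => m _; case: (A m).
    apply: runs_set => //.
      rewrite -[reach _ _ _]/(maxn 0 (maxn 0
        (eval w s1 (2 * rlen)%ram * w + regs s1 rm).+1)).
      by rewrite base rm_x !max0n /horizon -addnS leq_add2l; lia.
    apply: runs_set => //; split=> //.
      by rewrite /= rm_x (small_const wn) modn_small ?addn1 // lt_word //; lia.
    rewrite -[LHS]/((regs s1 rout + eval w s1 (get_A rm)) %% 2 ^ w) bit rout_x.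
    rewrite big_nat_recr //= modn_small // lt_word //.
    by case: (A x); lia.
  by split; rewrite // big_geq.
- by move=> s' [].
by rewrite sum_nat_const_nat /=; lia.
Qed.

End Loops.

Lemma algorithmA_runs w n s :
  fits w n -> input_state w (divisor_list n) s ->
  runs w algorithmA s
    (50 + 34 * n +
     \sum_(1 <= i < top_divisor n) (80 + 30 * (n %/ next_divisor n i)))
    (horizon w n) (fun s' => regs s' rout = delta n).
Proof.
move=> wn [len D]; have n0 := n_gt0 wn.
have len_l : size (divisor_list n) = list_len n by rewrite size_map.
have l0 : 0 < list_len n := size_small_divisors_gt0 n0.
have D' k : k < list_len n ->
    get_word w s (2 * k) = nth 0 (small_divisors n) k /\
    get_word w s (2 * k + 1) = n %/ nth 0 (small_divisors n) k.
  rewrite -len_l => k_lt; have := D k k_lt.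
  by rewrite nth_divisor_list -?len_l.
have first1 : nth 0 (small_divisors n) 0 = 1.
  have one_in : 1 \in small_divisors n by rewrite mem_small_divisors ?dvd1n.
  have nth_in : nth 0 (small_divisors n) 0 \in small_divisors n.
    by rewrite mem_nth.
  have [k k_lt def_1] := small_divisors_nthP one_in.
  have := small_divisors_nth_leq (leq0n k) k_lt; rewrite def_1.
  move: nth_in; rewrite mem_small_divisors // => /andP[/(dvdn_gt0 n0)]; lia.
have eval_n : eval w s (D1 0) = n.
  rewrite /= !(small_const wn).
  by have [_] := D' 0 l0; rewrite first1 divn1.
set M := \sum_(1 <= i < _) _.
(* One summand for each command of the program, in order. *)
have sum_T : 10 + (2 + (2 + ((14 * n + 4) + (2 + ((M + 20) +
  (2 + (2 + (20 * n + 4)))))))) <= 50 + 34 * n + M by lia.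
apply: (runs_weaken sum_T (fun _ post => post)).
apply/runs_seq/runs_set => //.
  rewrite /= !(small_const wn) !max0n.
  by apply: leq_trans (leq_addr _ _); rewrite leq_mul2r; lia.
rewrite eval_n; have F1 : frame w n (set_reg s rn n).
  by split=> //=; rewrite len.
apply/runs_seq/runs_set => //; apply/runs_seq/runs_set => //.
apply: runs_seq_post.
  by apply: (clear_runs wn) => //=; rewrite (small_const wn).
move=> s2 [F2 rk2 V2]; apply/runs_seq/runs_set => //.
apply: runs_seq_post.
  by apply: (mark_runs wn) => //=; rewrite (small_const wn).
move=> s3 [F3 V3]; apply/runs_seq/runs_set => //; apply/runs_seq/runs_set => //.
rewrite delta_sum //; apply: (weigh_runs wn) => //=.
1,2: by rewrite (small_const wn).
move=> m m_lt; apply/idP/idP => [/V3|] h.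
  by apply/(markedP n0 m_lt)/h.
by apply/V3 => //; apply/(markedP n0 m_lt).
Qed.

Theorem theorem2p5 (w : nat -> nat) (hw : theta_log w) :
  exists Ct Cs : nat, forall (n : nat) (s : state),
    0 < n -> input_state (w n) (divisor_list n) s ->
    exists (t h : nat) (s' : state),
      [/\ exec (w n) algorithmA s t h s',
          regs s' rout = delta n,
          t <= Ct * (n * tau_plus n) &
          space (w n) (divisor_list n) h <= Cs * n].
Proof.
(* Time: 50 + 34 n + 80 sqrt n + 30 * 2 n tau_plus, with all of these terms at
   most a multiple of n tau_plus.  Space: 2 l w <= 4 c n for the list of length l,
   n for the bit vector, and 8 w <= 8 c n for the registers. *)
case: hw => c hw; exists 224, (12 * c + 1) => n s n0 input.
have [w1 n_lt w_le] := hw n n0.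
have wn : fits (w n) n by [].
have [t [h [s' [ex t_le h_le out]]]] := algorithmA_runs wn input.
exists t, h, s'; split=> //.
  apply: leq_trans t_le _; rewrite big_split /= sum_nat_const_nat -big_distrr /=.
  have := sum_next_divisor n0; have := tau_plus_gt0 n0.
  have := top_divisor_sq n0; nia.
have len_l : size (divisor_list n) = list_len n by rewrite size_map.
have l_log := size_mul_log n0; have log_le := trunc_log_lt n0.
rewrite /space len_l /nreg.
move: h_le l_log; rewrite /horizon -/(list_len n).
nia.
Qed.
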